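(* Let $L=\big((p_1,q_1),\ldots,(p_n,q_n)\big)$ be a lattice diagram with $n$ distinct cells in the positive quadrant. For any partition $\lambda$ of an integer $k\ge 1$ we have $$S_\lambda(\partial X)\,\Delta_L(X;Y)=\sum_{T\in\mathcal{T}_\lambda}\epsilon'(T,L)\,\Delta_{\partial T(L)}(X;Y),$$ where $\partial T(L)$ is the lattice diagram obtained from $L$ by replacing each biexponent $(p_i,q_i)$ with $(p_i-|T^{-1}(i)|,q_i)$ for $1\le i\le n$. The coefficient $\epsilon'(T,L)$ is as follows: let $T_1,T_2,\ldots,T_\ell$ be the $\ell$ columns of $T$ (from left to right), so that $\partial T(L)=\partial T_1\partial T_2\cdots\partial T_\ell(L)$; then $$\epsilon'(T,L)=\epsilon\big(\partial T_1\partial T_2\cdots\partial T_\ell(L)\big)\cdots\epsilon\big(\partial T_{\ell-1}\partial T_\ell(L)\big)\,\epsilon\big(\partial T_\ell(L)\big)=\prod_{m=1}^{\ell}\epsilon\big(\partial T_m\partial T_{m+1}\cdots\partial T_\ell(L)\big).$$ In particular $\epsilon'(T,L)$ is $0$ or $1$.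
   Context: Lattice diagrams. A lattice cell is a pair $(p,q)$ of integers; it is in the positive quadrant if $p\ge 0$ and $q\ge 0$. Cells are ordered by $$(p_1,q_1)<(p_2,q_2)\iff q_1<q_2\ \text{ or }\ [q_1=q_2\text{ and }p_1<p_2].$$ A lattice diagram is a finite list $L=\big((p_1,q_1),\ldots,(p_n,q_n)\big)$ of lattice cells with $(p_1,q_1)\le\cdots\le(p_n,q_n)$ in this order. The pairs $(p_i,q_i)$ are also called biexponents. Determinants. Let $X=x_1,\ldots,x_n$ and $Y=y_1,\ldots,y_n$ be variables, with polynomials taken over $\mathbb{Q}$. The lattice diagram determinant is $$\Delta_L(X;Y)=\det\left\|\frac{x_i^{p_j}y_i^{q_j}}{p_j!\,q_j!}\right\|_{i,j=1}^n .$$ It vanishes if a cell is repeated, and by convention $\Delta_L(X;Y)=0$ if some cell has a negative coordinate. For a polynomial $P(X)$, $P(\partial X)$ denotes the differential operator obtained by substituting $\partial/\partial x_i$ for each $x_i$. Partitions and tableaux. A partition $\lambda=(\lambda_1\ge\cdots\ge\lambda_r>0)$ is identified with its Ferrers diagram $\{(i,j):0\le i\le r-1,\ 0\le j\le\lambda_{i+1}-1\}$ (here $i$ is the row and $j$ the column). Its conjugate is $\lambda'=(\lambda'_1,\ldots,\lambda'_\ell)$, so $\ell=\lambda_1$ is the number of columns. A column-strict Young tableau of shape $\lambda$ is a map $T:\lambda\to\{1,2,\ldots,n\}$ ($n$ being the number of cells of $L$, equivalently of $x$-variables) with $T(i,j)\le T(i,j+1)$ and $T(i,j)<T(i+1,j)$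 wherever defined. $\mathcal{T}_\lambda$ is the set of all of them. The $m$-th column $T_m$ of $T$ is the restriction of $T$ to the cells $(i,m-1)$ of $\lambda$; it is regarded as a one-column tableau. Schur polynomial. $S_\lambda(X)=\det\|e_{\lambda'_j+i-j}(X)\|_{1\le i,j\le\ell}$, where $e_k(X)$ is the $k$-th elementary symmetric polynomial in $x_1,\ldots,x_n$, $e_0=1$ and $e_k=0$ for $k<0$. Equivalently $S_\lambda(X)=\sum_{T\in\mathcal{T}_\lambda}\prod_{i=1}^n x_i^{|T^{-1}(i)|}$. Operators on diagrams. For a tableau, or a single column, $U$ with entries in $\{1,\ldots,n\}$, $\partial U(L)$ replaces the $i$-th biexponent $(p_i,q_i)$ by $(p_i-|U^{-1}(i)|,q_i)$ for every $i$, each cell keeping its index $i$ in the list. In $\partial T_m\cdots\partial T_\ell(L)$, $\partial T_\ell$ is applied first, then $\partial T_{\ell-1}$, and so on. The function $\epsilon$. $\epsilon(L)=1$ if $L$ has $n$ distinct cells in the positive quadrant, and $\epsilon(L)=0$ otherwise. *)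

(* Defs.v *)
From HB Require Import structures.
From mathcomp Require Import all_boot all_order all_algebra.
From mathcomp Require Import mpoly.

Set Implicit Arguments.
Unset Strict Implicit.
Unset Printing Implicit Defensive.

Import Order.TTheory GRing.Theory Num.Theory.
Local Open Scope ring_scope.

(* Indices are 0-based throughout: x_i, y_i, cells of a diagram, rows, columns
   and tableau entries all start at 0. *)

(** Lattice cells and diagrams *)

Definition lcell : Type := (int * int)%type.

Definition cell_le (c d : lcell) : bool :=
  (c.2 < d.2) || (c.2 == d.2) && (c.1 <= d.1).

Definition in_quadrant (c : lcell) : bool := (0 <= c.1) && (0 <= c.2).

(* Operators act on arbitrary lists of cells, since they need not preserve
   sortedness. *)
Definition is_diagram n (L : n.-tuple lcell) : bool := sorted cell_le L.

Definition eps n (L : n.-tuple lcell) : nat := uniq L && all in_quadrant L.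

(** Polynomials in x_0..x_(n-1), y_0..y_(n-1) over the rationals *)

Definition xvar n (i : 'I_n) : {mpoly rat[n + n]} := 'X_(lshift n i).
Definition yvar n (i : 'I_n) : {mpoly rat[n + n]} := 'X_(rshift n i).

Definition Delta n (L : n.-tuple lcell) : {mpoly rat[n + n]} :=
  if all in_quadrant L then
    \det (\matrix_(i < n, j < n)
      let p := `|(tnth L j).1|%N in
      let q := `|(tnth L j).2|%N in
      ((p`! * q`!)%N%:R^-1 : rat) *: (xvar i ^+ p * yvar i ^+ q))
  else 0.

Definition xmonom n (m : 'X_{1..n}) : 'X_{1..n + n} :=
  [multinom (match split i with inl j => m j | inr _ => 0%N end) | i < n + n].

(* P(∂X) Q: each monomial x^m of P acts as the iterated derivative of
   multi-order m in the x variables. *)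
Definition diffX n (P : {mpoly rat[n]}) (Q : {mpoly rat[n + n]}) :
    {mpoly rat[n + n]} :=
  \sum_(m <- msupp P) P@_m *: mderivm (xmonom m) Q.

(** Partitions and tableaux *)

Definition is_partition (k : nat) (lam : seq nat) : bool :=
  [&& sorted geq lam, all (fun r => 0 < r)%N lam & sumn lam == k]%N.

Definition ncols (lam : seq nat) : nat := head 0%N lam.

(* conj_part lam j is the length of column j, i.e. the number of rows of
   length > j. *)
Definition conj_part (lam : seq nat) (j : nat) : nat :=
  count (fun r => j < r)%N lam.

Definition in_ferrers (lam : seq nat) (c : 'I_(size lam) * 'I_(ncols lam)) :
    bool := (c.2 < nth 0%N lam c.1)%N.

Definition ferrers (lam : seq nat) : finType :=
  {c : 'I_(size lam) * 'I_(ncols lam) | in_ferrers c}.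

Definition frow lam (c : ferrers lam) : nat := (val c).1.
Definition fcol lam (c : ferrers lam) : nat := (val c).2.

Definition column_strict n lam (T : {ffun ferrers lam -> 'I_n}) : bool :=
  [forall c, forall d,
    (((frow d == frow c) && (fcol d == (fcol c).+1)) ==> (T c <= T d)%N) &&
    (((frow d == (frow c).+1) && (fcol d == fcol c)) ==> (T c < T d)%N)].

Definition tableaux n lam : {set {ffun ferrers lam -> 'I_n}} :=
  [set T | column_strict T].

Definition column n lam (T : {ffun ferrers lam -> 'I_n}) (m : nat) :
    {ffun {c : ferrers lam | fcol c == m} -> 'I_n} :=
  [ffun c => T (val c)].

(** Operators on diagrams; D is the set of cells of a tableau or of a single
    column. *)

Definition lower n (D : finType) (U : {ffun D -> 'I_n}) (L : n.-tuple lcell) :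
    n.-tuple lcell :=
  [tuple ((tnth L i).1 - #|[set c | U c == i]|%:Z, (tnth L i).2) | i < n].

(* Applies the columns ncols lam - 1, ..., m + 1, m of T, in this order. *)
Definition lower_cols n lam (T : {ffun ferrers lam -> 'I_n}) (m : nat)
    (L : n.-tuple lcell) : n.-tuple lcell :=
  foldr (fun j => lower (column T j)) L (iota m (ncols lam - m)%N).

Definition eps' n lam (T : {ffun ferrers lam -> 'I_n}) (L : n.-tuple lcell) :
    nat :=
  (\prod_(m < ncols lam) eps (lower_cols T m L))%N.

(** Schur polynomials *)

Definition esym n (z : int) : {mpoly rat[n]} :=
  if z is Posz k then mesym n rat k else 0.

Definition schur n (lam : seq nat) : {mpoly rat[n]} :=
  \det (\matrix_(i < ncols lam, j < ncols lam)
    esym n ((conj_part lam j)%:Z + i%:Z - j%:Z)).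

(* Main.v *)
Require Import Defs.
From mathcomp Require Import all_boot all_order all_algebra all_fingroup.
From mathcomp Require Import mpoly.
From mathcomp Require Import zify.
Import Order.TTheory GRing.Theory Num.Theory.
Local Open Scope ring_scope.

Set Implicit Arguments.
Unset Strict Implicit.
Unset Printing Implicit Defensive.

(** A tableau is recorded by the sets of entries of its columns, a family
    A j of subsets of {0, ..., n-1}. A family comes from a column-strict tableau
    of shape lam exactly when A j has the length of column j and, for every v,
    the number of entries below v weakly decreases from column to column
    ([dominated]; the correspondence is [sum_tableaux]).

    The scaled monomial x^p / p! is sent to x^(p-1) / (p-1)! by d/dx. Hence a
    symmetric polynomial that is a sum of monomials x^m acts on Delta_L by
    subtracting each exponent vector m from the cells of L ([diffX_sum_Delta]).
    The Schur polynomial is such a sum: expanding the determinant in the e_k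
    gives signed families of column sets with the wrong sizes allowed, and
    exchanging the tails of two neighbouring columns at the first level where
    their counts are out of order cancels all but the dominated ones
    ([dual_jacobi_trudi]). Therefore S_lam(dX) Delta_L is the sum of
    Delta of dT(L) over all column-strict tableaux T, with coefficient 1.

    It remains to see that the tableaux with coefficient 0 contribute nothing
    ([sum_Delta_eps]). If a cell leaves the quadrant on the way it never comes
    back, so the determinant is 0. Otherwise two cells collide on the way.
    Lowering by one column moves each cell by at most one step, so when a
    collision first occurs, the cells of two consecutive indices k, k+1 have
    become equal. Then, as in Stembridge's proof of the
    Littlewood-Richardson rule, a Bender-Knuth involution exchanging k and k+1
    in the columns still to be applied keeps T column-strict and exchanges the
    final positions of these two cells, which changes the sign of the
    determinant ([sum_Delta_no_collision]). *)

(** * Symmetric differential operators on lattice determinants *)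

Definition cell_monomial n (c : lcell) (i : 'I_n) : {mpoly rat[n + n]} :=
  if in_quadrant c then
    ((`|c.1|%N`! * `|c.2|%N`!)%N%:R^-1 : rat) *:
      (xvar i ^+ `|c.1|%N * yvar i ^+ `|c.2|%N)
  else 0.

Definition diagonal_product n (c : 'I_n -> lcell) : {mpoly rat[n + n]} :=
  \prod_(i < n) cell_monomial (c i) i.

Definition shift_diagram n (L : n.-tuple lcell) (m : 'X_{1..n}) :
    n.-tuple lcell :=
  [tuple ((tnth L i).1 - (m i)%:Z, (tnth L i).2) | i < n].

(** The case split in [Delta] is absorbed by the convention that the monomial
    of a cell outside the quadrant is 0: such a cell gives a zero factor in
    every Leibniz term. *)
Lemma DeltaE n (L : n.-tuple lcell) :
  Delta L = \sum_(s : 'S_n) (-1) ^+ s * diagonal_product (fun i => tnth L (s i)).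
Proof.
rewrite /Delta; case: ifPn => [/all_tnthP Lq | /allPn [c /tnthP [j ->] cNq]].
  apply: eq_bigr => s _; congr (_ * _); apply: eq_bigr => i _.
  by rewrite mxE /cell_monomial Lq.
apply/esym/big1 => s _; rewrite /diagonal_product (bigD1 (s^-1 j)%g) //=.
by rewrite permKV /cell_monomial (negbTE cNq) mul0r mulr0.
Qed.

Lemma Delta_swap n (L L' : n.-tuple lcell) (a b : 'I_n) :
  a != b -> (forall i, tnth L' i = tnth L (tperm a b i)) ->
  Delta L' = - Delta L.
Proof.
move=> ab LL'; rewrite !DeltaE (reindex_inj (mulIg (tperm a b))) /= -sumrN.
apply: eq_bigr => s _; rewrite odd_permM odd_tperm ab signr_addb mulrN1 mulNr.
congr (- (_ * _)); apply: eq_bigr => i _.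
by rewrite LL' permM tpermK.
Qed.

Lemma Delta_out_of_quadrant n (L : n.-tuple lcell) :
  ~~ all in_quadrant L -> Delta L = 0.
Proof. by rewrite /Delta => /negbTE ->. Qed.

Lemma diagonal_productE n (c : 'I_n -> lcell) :
  (forall i, in_quadrant (c i)) ->
  diagonal_product c =
    (\prod_(i < n) ((`|(c i).1|%N`! * `|(c i).2|%N`!)%N%:R^-1 : rat)) *:
    'X_[[multinom (match split i with
                   | inl j => `|(c j).1|%N | inr j => `|(c j).2|%N end)
        | i < n + n]].
Proof.
move=> cq; rewrite /diagonal_product.
under eq_bigr => i _ do rewrite /cell_monomial cq.
rewrite scaler_prod mpolyXE_id big_split_ord /= -big_split /=; congr (_ *: _).
apply: eq_bigr => i _; rewrite !mnmE.
by rewrite -[lshift n i]/(unsplit (inl i)) -[rshift n i]/(unsplit (inr i)) !unsplitK.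
Qed.

(** Applying d/dx once turns x^p/p! into x^(p-1)/(p-1)!, and kills it when
    p = 0: this is why the determinant is normalised by factorials, and why
    cells with a negative coordinate stand for the zero polynomial. *)
Lemma mderivm_diagonal_product n (c : 'I_n -> lcell) (m : 'X_{1..n}) :
  (forall i, in_quadrant (c i)) ->
  mderivm (xmonom m) (diagonal_product c) =
    diagonal_product (fun i => ((c i).1 - (m i)%:Z, (c i).2)).
Proof.
move=> cq; rewrite diagonal_productE // mderivmZ mderivmX scalerA natr_prod.
rewrite big_split_ord /=.
have xl (f g : 'I_n -> nat) (i : 'I_n) :
    [multinom (match split j with inl j => f j | inr j => g j end) | j < n + n]
      (lshift n i) = f i.
  by rewrite mnmE -[lshift n i]/(unsplit (inl i)) unsplitK.
have xr (f g : 'I_n -> nat) (i : 'I_n) :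
    [multinom (match split j with inl j => f j | inr j => g j end) | j < n + n]
      (rshift n i) = g i.
  by rewrite mnmE -[rshift n i]/(unsplit (inr i)) unsplitK.
under [X in _ * (X * _)]eq_bigr => i _ do rewrite !xl.
rewrite [X in _ * (_ * X)]big1 ?mulr1; last by move=> i _; rewrite !xr ffactn0.
rewrite -big_split /=.
case: (boolP [forall i, m i <= `|(c i).1|]%N) => [/forallP le_m | /forallPn [i lt_m]].
  rewrite diagonal_productE => [|i]; last first.
    by have := cq i; have := le_m i; rewrite /in_quadrant /=; lia.
  congr (_ *: 'X_[_]).
    apply: eq_bigr => i _ /=.
    have -> : `|(c i).1 - (m i)%:Z|%N = (`|(c i).1| - m i)%N.
      by have := cq i; have := le_m i; rewrite /in_quadrant /=; lia.
    rewrite -(ffact_fact (le_m i)) !natrM !invfM.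
    set u := (_ ^_ _)%:R; have u0 : u != 0 by rewrite pnatr_eq0 -lt0n ffact_gt0.
    by rewrite mulrC !mulrA mulfV // mul1r.
  apply/mnmP => i; rewrite mnmBE !mnmE.
  case: splitP => j _; last by rewrite subn0.
  by have := cq j; have := le_m j; rewrite /in_quadrant /=; lia.
rewrite (bigD1 i) //= ffact_small ?mulr0 ?mul0r ?scale0r; last by rewrite ltnNge.
rewrite /diagonal_product (bigD1 i) //= /cell_monomial ifF ?mul0r //.
by have := cq i; move: lt_m; rewrite /in_quadrant /=; lia.
Qed.

(** Differentiating the term of a permutation s lowers the cells in the order
    prescribed by s, so that different terms of the Leibniz expansion are
    lowered along different rearrangements of the exponent m. Symmetry of P
    lets each term use its own rearrangement, which reassembles determinants. *)
Lemma diffX_Delta n (P : {mpoly rat[n]}) (L : n.-tuple lcell) :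
  P \is symmetric -> all in_quadrant L ->
  diffX P (Delta L) = \sum_(m <- msupp P) P@_m *: Delta (shift_diagram L m).
Proof.
move=> symP /all_tnthP Lq; rewrite /diffX DeltaE.
under eq_bigr => m _ do rewrite linear_sum scaler_sumr.
under [RHS]eq_bigr => m _ do rewrite DeltaE scaler_sumr.
rewrite exchange_big [RHS]exchange_big /=; apply: eq_bigr => s _.
rewrite [RHS](perm_big
  [seq [multinom m (s^-1 i)%g | i < n] | m : 'X_{1..n} <- msupp P]) /=.
  rewrite big_map; apply: eq_bigr => m _.
  rewrite -mcoeff_sym (issymP _ symP) //; congr (_ *: _).
  have -> : diagonal_product (fun i => tnth (shift_diagram L
      [multinom m ((s^-1)%g i) | i < n]) (s i)) =
      mderivm (xmonom m) (diagonal_product (fun i => tnth L (s i))).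
    rewrite mderivm_diagonal_product; last by move=> i; apply: Lq.
    by apply: eq_bigr => i _; rewrite tnth_mktuple mnmE permK.
  by rewrite !mulr_sign; case: (odd_perm s); rewrite //= linearN.
have inj_h : injective (fun m : 'X_{1..n} => [multinom m (s^-1 i)%g | i < n]).
  exact: mperm_inj.
apply: uniq_perm => [||m]; rewrite ?(map_inj_uniq inj_h) ?msupp_uniq //.
apply/idP/mapP => [mP | [m' m'P ->]].
  exists [multinom m (s i) | i < n]; first by rewrite issym_msupp.
  by apply/mnmP => i; rewrite !mnmE permKV.
by rewrite issym_msupp.
Qed.

(** All coefficients being 1, no monomial cancels, so that the sum over the
    support of P can be traded for the sum over the index set. *)
Lemma diffX_sum_Delta n (I : finType) (Q : pred I) (w : I -> 'X_{1..n})
    (L : n.-tuple lcell) :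
  \sum_(a | Q a) 'X_[w a] \is @symmetric n rat -> all in_quadrant L ->
  diffX (\sum_(a | Q a) 'X_[w a]) (Delta L) =
    \sum_(a | Q a) Delta (shift_diagram L (w a)).
Proof.
move=> symP Lq; rewrite diffX_Delta //; set P := \sum_(a | Q a) _.
have coefP m : P@_m = \sum_(a | Q a) (w a == m)%:R.
  by rewrite raddf_sum /=; apply: eq_bigr => a _; rewrite mcoeffX.
under eq_bigr => m _ do rewrite coefP scaler_suml.
rewrite exchange_big /=; apply: eq_bigr => a Qa.
rewrite (bigD1_seq (w a)) ?msupp_uniq //=; last first.
  rewrite mcoeff_msupp coefP (bigD1 a) //= eqxx gt_eqF // ltr_wpDr ?ltr01 //.
  by apply: sumr_ge0 => b _; rewrite ler0n.
rewrite eqxx scale1r big1 ?addr0 // => m /negbTE mw.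
by rewrite eq_sym mw scale0r.
Qed.

(** * Sign-reversing involutions *)

(** The index j is the place where f acts; since the set of admissible places
    is unchanged by the move, choosing one of them arbitrarily, by [pick], still
    defines an involution. *)
Lemma sum_sign_reversing (V : lmodType rat) (I J : finType) (Q : pred I)
    (R : I -> pred J) (f : J -> I -> I) (F : I -> V) :
    (forall x j, Q x -> R x j ->
      [/\ Q (f j x), R (f j x) =1 R x, f j (f j x) = x & F (f j x) = - F x]) ->
  \sum_(x | Q x) F x = \sum_(x | Q x && [forall j, ~~ R x j]) F x.
Proof.
move=> fP; rewrite (bigID (fun x => [forall j, ~~ R x j])) /=.
set S := (X in _ + X = _); suff -> : S = 0 by rewrite addr0.
pose g x := if Q x then if pick (R x) is Some j then f j x else x else x.
have pickR x j : pick (R x) = Some j -> R x j.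
  by case: pickP => // k Rk [<-].
have gK : involutive g.
  move=> x; rewrite /g; case Qx: (Q x); rewrite ?Qx //.
  case E: (pick (R x)) => [j|]; last by rewrite Qx E.
  have [-> eqR fK _] := fP x j Qx (pickR _ _ E).
  by rewrite (eq_pick eqR) E.
suff SN : S = - S.
  have : (2%:R : rat) *: S = 0 by rewrite scaler_nat mulr2n {1}SN addNr.
  by move/eqP; rewrite scaler_eq0 => /orP[|/eqP].
rewrite {1}/S (reindex_inj (inv_inj gK)) -sumrN; symmetry; apply: eq_big => x.
  rewrite /g; case Qx: (Q x); rewrite ?Qx //.
  case E: (pick (R x)) => [j|]; last by rewrite Qx.
  have [-> eqR _ _] := fP x j Qx (pickR _ _ E).
  by congr (~~ _); apply: eq_forallb => k; rewrite eqR.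
case/andP => Qx /forallPn[j]; rewrite negbK => Rj; rewrite /g Qx.
case E: (pick (R x)) => [k|].
  by have [_ _ _ ->] := fP x k Qx (pickR _ _ E).
by move: E; case: pickP => // /(_ j); rewrite Rj.
Qed.

(** * Families of column sets and the dual Jacobi-Trudi identity *)

Definition count_below n (v : nat) (S : {set 'I_n}) : nat :=
  #|[set u in S | (u < v)%N]|.

Lemma count_belowS n (u : 'I_n) (S : {set 'I_n}) :
  count_below u.+1 S = ((u \in S) + count_below u S)%N.
Proof.
rewrite /count_below (cardsD1 u) !inE ltnSn andbT; congr addn.
apply: eq_card => w; rewrite !inE -val_eqE /= ltnS; case: (w \in S); rewrite ?andbF //.
by rewrite ltn_neqAle.
Qed.

Lemma count_below_all n v (S : {set 'I_n}) : (n <= v)%N -> count_below v S = #|S|.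
Proof.
by move=> nv; apply: eq_card => u; rewrite inE (leq_trans (ltn_ord u) nv) andbT.
Qed.

Lemma count_below0 n (S : {set 'I_n}) : count_below 0 S = 0%N.
Proof. by apply: eq_card0 => u; rewrite inE andbF. Qed.

Lemma card_count_below n v (S : {set 'I_n}) :
  #|S| = (count_below v S + #|[set u in S | (v <= u)%N]|)%N.
Proof.
rewrite -(cardsID [set u : 'I_n | (u < v)%N] S); congr (_ + _)%N; apply: eq_card => u.
  by rewrite !inE.
by rewrite !inE andbC -leqNgt.
Qed.

Notation column_family n l := {ffun 'I_l -> {set 'I_n}}.

Definition weight n l (A : column_family n l) : 'X_{1..n} :=
  (\sum_(j < l) mesym1 (A j))%MM.

Definition dominated n l (A : column_family n l) : bool :=
  [forall v : 'I_n.+1, forall j : 'I_l, forall j' : 'I_l,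
    (j <= j')%N ==> (count_below v (A j') <= count_below v (A j))%N].

Lemma dominatedP n l (A : column_family n l) :
  reflect (forall v (j j' : 'I_l), (j <= j')%N ->
             (count_below v (A j') <= count_below v (A j))%N)
          (dominated A).
Proof.
apply: (iffP idP) => [domA v j j' jj' | domA]; last first.
  by apply/forallP=> v; apply/forallP=> j; apply/forallP=> j'; apply/implyP/domA.
have main w : (w <= n)%N -> (count_below w (A j') <= count_below w (A j))%N.
  move=> wn; have /forallP/(_ j)/forallP/(_ j')/implyP :=
    forallP domA (Ordinal (wn : (w < n.+1)%N)).
  exact.
have [/main //|/ltnW nv] := leqP v n.
by have := main _ (leqnn n); rewrite !count_below_all.
Qed.

Notation site n l := ('I_n.+1 * ('I_l * 'I_l))%type.

Definition crossing n l (A : column_family n l) (q : site n l) :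
    bool :=
  (q.2.1.+1 == q.2.2)%N && (count_below q.1 (A q.2.1) < count_below q.1 (A q.2.2))%N.

Definition first_crossing n l (A : column_family n l)
    (q : site n l) : bool :=
  crossing A q && [forall q' : site n l, (q'.1 < q.1)%N ==> ~~ crossing A q'].

Lemma dominated_adjacent n l (A : column_family n l) :
  (forall v (j j' : 'I_l), (j.+1 = j')%N -> (v <= n)%N ->
     (count_below v (A j') <= count_below v (A j))%N) ->
  dominated A.
Proof.
move=> adj; apply/forallP => v; apply/forallP => j; apply/forallP => j'.
apply/implyP => jj'; have vn : (v <= n)%N by rewrite -ltnS.
move: (j' - j)%N (subnK jj') => d.
elim: d j' {jj'} => [|d IHd] j' E; first by rewrite (_ : j' = j) //; apply: val_inj.
have lt_p : (d + j < l)%N by have := ltn_ord j'; lia.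
apply: leq_trans (IHd (Ordinal lt_p) erefl); apply: adj => //=; lia.
Qed.

Lemma no_first_crossing n l (A : column_family n l) :
  [forall q, ~~ first_crossing A q] = dominated A.
Proof.
apply/forallP/idP => [noX | /dominatedP domA [v [j j']]]; last first.
  rewrite negb_and; apply/orP; left; rewrite /crossing /= negb_and.
  by case: eqP => //= jj'; rewrite -leqNgt domA // -jj' leqnSn.
have main : forall w (q : site n l), (q.1 < w)%N -> ~~ crossing A q.
  elim=> [//|w IHw] q; rewrite ltnS => le_w; apply/negP => Xq.
  have /negP := noX q; apply; rewrite /first_crossing Xq /=.
  by apply/forallP => q'; apply/implyP => lt_q; apply: IHw; apply: leq_trans le_w.
apply: dominated_adjacent => v j j' jj' vn.
have /= := main n.+1 (Ordinal (vn : (v < n.+1)%N), (j, j')) (ltn_ord _).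
by rewrite /crossing /= jj' eqxx -leqNgt.
Qed.

(** Each count grows by at most one from a level to the next, and all counts
    vanish at level 0, so the order of two columns is first violated by one. *)
Lemma first_crossing_step n l (A : column_family n l) v (j j' : 'I_l) :
  first_crossing A (v, (j, j')) ->
  j.+1 = j' :> nat /\ count_below v (A j') = (count_below v (A j)).+1.
Proof.
case/andP => /andP[/= /eqP jj' lt_c] /forallP noX; split=> //.
case: v lt_c noX => [[|v] vn] /= lt_c noX; first by move: lt_c; rewrite !count_below0.
have /= := noX (Ordinal (ltnW vn), (j, j')).
rewrite ltnSn /crossing /= jj' eqxx /= -leqNgt => le_c.
have := count_belowS (Ordinal (vn : (v < n)%N)) (A j).
have := count_belowS (Ordinal (vn : (v < n)%N)) (A j').
move: lt_c le_c => /=; lia.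
Qed.

Definition swap_tails n l (v : nat) (j j' : 'I_l) (A : column_family n l) :
    column_family n l :=
  [ffun i : 'I_l => [set u : 'I_n |
    if (u < v)%N then u \in A i else u \in A (tperm j j' i)]].

Lemma swap_tailsK n l v (j j' : 'I_l) :
  involutive (@swap_tails n l v j j').
Proof.
move=> A; apply/ffunP => i; rewrite ffunE; apply/setP => u; rewrite !ffunE !inE.
by case: ltnP => /= uv; rewrite ?tpermK.
Qed.

Lemma count_below_swap_tails n l v (j j' : 'I_l) (A : column_family n l) w i :
  (w <= v)%N -> count_below w (swap_tails v j j' A i) = count_below w (A i).
Proof.
move=> wv; apply: eq_card => u; rewrite !ffunE !inE.
by case: (ltnP u w) => [uw | _]; rewrite ?andbF // (leq_trans uw wv).
Qed.

Lemma card_swap_tails n l v (j j' : 'I_l) (A : column_family n l) i :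
  (#|swap_tails v j j' A i| + count_below v (A (tperm j j' i)) =
   count_below v (A i) + #|A (tperm j j' i)|)%N.
Proof.
rewrite (card_count_below v (swap_tails _ _ _ _ _)) count_below_swap_tails //.
rewrite (card_count_below v (A (tperm j j' i))) -!addnA; congr (_ + _)%N.
rewrite addnC; congr (_ + _)%N; apply: eq_card => u; rewrite !ffunE !inE.
by case: ltnP; rewrite ?andbF.
Qed.

Lemma weight_swap_tails n l v (j j' : 'I_l) (A : column_family n l) :
  weight (swap_tails v j j' A) = weight A.
Proof.
apply/mnmP => u; rewrite !mnm_sumE; case: (ltnP u v) => uv.
  by apply: eq_bigr => i _; rewrite !mnmE ffunE inE uv.
rewrite [RHS](reindex_inj (@perm_inj _ (tperm j j'))) /=.
by apply: eq_bigr => i _; rewrite !mnmE ffunE inE ltnNge uv.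
Qed.

(** A crossing at level w only involves entries below w, which the exchange of
    the entries at or above v leaves alone when w <= v. *)
Lemma first_crossing_swap_tails n l (A : column_family n l) v j j' :
  first_crossing A (v, (j, j')) ->
  first_crossing (swap_tails v j j' A) =1 first_crossing A.
Proof.
move=> XA; pose A' := swap_tails v j j' A.
have eqX (q : site n l) : (q.1 <= v)%N -> crossing A' q = crossing A q.
  by move=> qv; rewrite /crossing !count_below_swap_tails.
have XA' : first_crossing A' (v, (j, j')).
  case/andP: XA => XA /forallP noX; rewrite /first_crossing eqX // XA.
  apply/forallP => q; apply/implyP => qv; rewrite eqX ?(ltnW qv) //.
  exact: (implyP (noX q)).
move=> q; have [qv | vq] := leqP q.1 v.
  rewrite /first_crossing eqX //; congr (_ && _); apply: eq_forallb => q'.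
  by case: ltnP => //= q'q; rewrite eqX // ltnW // (leq_trans q'q).
have noq B : first_crossing B (v, (j, j')) -> first_crossing B q = false.
  case/andP=> XB _; apply/negbTE; rewrite negb_and; apply/orP; right.
  by apply/forallPn; exists (v, (j, j')); rewrite /= vq XB.
by rewrite !noq.
Qed.

Lemma esymE n (z : int) :
  Defs.esym n z = \sum_(S : {set 'I_n} | #|S|%:Z == z) 'X_[mesym1 S].
Proof.
case: z => [k | k] /=; first by rewrite mesymE; apply: eq_bigl => S.
by rewrite big_pred0.
Qed.

(** The sum runs over permutations and families whose sizes are prescribed by
    the permutation; a negative index of e_k prescribes an impossible size. *)
Lemma leibniz_esym n l (h : 'I_l -> nat) :
  \det (\matrix_(i < l, j < l) Defs.esym n ((h j)%:Z + i%:Z - j%:Z)) =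
  \sum_(x : 'S_l * column_family n l |
         [forall i, #|x.2 i|%:Z == (h (x.1 i))%:Z + i%:Z - (x.1 i)%:Z])
     (-1) ^+ x.1 * 'X_[weight x.2].
Proof.
pose P (s : 'S_l) i := [pred S : {set 'I_n} |
  #|S|%:Z == (h (s i))%:Z + i%:Z - (s i)%:Z].
rewrite -(pair_big_dep predT (fun s (A : column_family n l) => A \in family (P s))
  (fun s A => (-1) ^+ s * 'X_[weight A])) /=.
apply: eq_bigr => s _; rewrite -mulr_sumr; congr (_ * _).
transitivity (\prod_(i < l) \sum_(S | P s i S) 'X_[mesym1 S] : {mpoly rat[n]}).
  by apply: eq_bigr => i _; rewrite mxE esymE.
rewrite (bigA_distr_big_dep (fun i S => P s i S)); apply: eq_bigr => A _.
by rewrite mprodXE.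
Qed.

Lemma increasing_perm_id l (s : 'S_l) :
  (forall i j : 'I_l, (i < j)%N -> (s i < s j)%N) -> s = 1%g.
Proof.
have ge_id (t : 'S_l) : (forall i j : 'I_l, (i < j)%N -> (t i < t j)%N) ->
    forall i : 'I_l, (i <= t i)%N.
  move=> mono_t [i lt_i] /=; elim: i lt_i => [//|i IHi] lt_i.
  apply: leq_ltn_trans (IHi (ltnW lt_i)) _; exact: mono_t.
move=> mono_s; have mono_s' (i j : 'I_l) : (i < j)%N -> (s^-1%g i < s^-1%g j)%N.
  move=> ij; rewrite ltnNge; apply/negP; rewrite leq_eqVlt => /orP[/eqP/val_inj/perm_inj E|].
    by rewrite E ltnn in ij.
  by move/mono_s; rewrite !permKV ltnNge ltnW.
apply/permP => i; rewrite perm1; apply/val_inj/eqP; rewrite eqn_leq ge_id // andbT.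
by have := ge_id _ mono_s' (s i); rewrite permK.
Qed.

(** For a dominated family both i |-> #|A i| - i and i |-> h i - i are strictly
    decreasing, so the permutation relating their values is increasing. *)
Lemma dominated_sizes n l (h : 'I_l -> nat) (s : 'S_l) (A : column_family n l) :
  (forall i j : 'I_l, (i <= j)%N -> (h j <= h i)%N) -> dominated A ->
  [forall i, #|A i|%:Z == (h (s i))%:Z + i%:Z - (s i)%:Z] =
  (s == 1%g) && [forall i, #|A i| == h i].
Proof.
move=> decr_h /dominatedP domA; apply/idP/andP; last first.
  case=> /eqP-> /forallP szA; apply/forallP => i.
  by rewrite perm1 (eqP (szA i)) addrK.
move/forallP => szA; suff s1 : s = 1%g.
  split; first exact/eqP.
  by apply/forallP => i; have := szA i; rewrite s1 perm1 addrK.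
apply: increasing_perm_id => i j ij.
have le_A : (#|A j| <= #|A i|)%N.
  by have := domA n i j (ltnW ij); rewrite !count_below_all.
rewrite ltnNge; apply/negP => le_s; have := decr_h _ _ le_s.
have := szA i; have := szA j; lia.
Qed.

(** Exchanging tails at a first crossing, where the counts differ by one, turns
    the sizes of columns j, j+1 into #|A (j+1)| - 1 and #|A j| + 1. These are the
    sizes prescribed by the permutation composed with the transposition, which
    has the opposite sign. The weight is unchanged. *)
Theorem dual_jacobi_trudi n l (h : 'I_l -> nat) :
  (forall i j : 'I_l, (i <= j)%N -> (h j <= h i)%N) ->
  \det (\matrix_(i < l, j < l) Defs.esym n ((h j)%:Z + i%:Z - j%:Z)) =
  \sum_(A : column_family n l | dominated A && [forall j, #|A j| == h j])
     'X_[weight A].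
Proof.
move=> decr_h; rewrite leibniz_esym.
rewrite (sum_sign_reversing (R := fun x q => first_crossing x.2 q)
  (f := fun q x => ((tperm q.2.1 q.2.2 * x.1)%g, swap_tails q.1 q.2.1 q.2.2 x.2))).
  rewrite (eq_bigl (fun x : 'S_l * column_family n l =>
    (pred1 1%g x.1) && (dominated x.2 && [forall i, #|x.2 i| == h i]))).
    rewrite -(pair_big (pred1 1%g)
       (fun A : column_family n l => dominated A && [forall i, #|A i| == h i])
       (fun (s : 'S_l) A => (-1) ^+ s * 'X_[weight A])) /= big_pred1_eq odd_perm1.
    by apply: eq_bigr => A _; rewrite mul1r.
  move=> [s A] /=; rewrite no_first_crossing andbC.
  by case domA: (dominated A); rewrite ?andbF //= dominated_sizes.
move=> [s A] [v [j j']] /= /forallP szA XA; have [jj' stepA] := first_crossing_step XA.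
have nj : j != j' by rewrite -val_eqE /= -jj' neq_ltn ltnSn.
split.
- apply/forallP => i; rewrite permM.
  have := card_swap_tails v j j' A i; have := szA (tperm j j' i); have := szA i.
  by case: tpermP => [->|->|_ _]; move: stepA jj' => /=; lia.
- exact: first_crossing_swap_tails.
- by rewrite mulgA tperm2 mul1g swap_tailsK.
- by rewrite weight_swap_tails odd_permM odd_tperm nj signr_addb mulN1r mulNr.
Qed.

(** * Reversing the order inside each level set *)

Section Mirror.
Variables (l : nat) (K : eqType) (g : 'I_l -> K).

Definition level_set (j : 'I_l) : seq 'I_l := [seq i <- enum 'I_l | g i == g j].

Definition mirror (j : 'I_l) : 'I_l :=
  nth j (rev (level_set j)) (index j (level_set j)).

Lemma mem_level_set j i : (i \in level_set j) = (g i == g j).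
Proof. by rewrite mem_filter mem_enum andbT. Qed.

Lemma level_set_uniq j : uniq (level_set j).
Proof. exact/filter_uniq/enum_uniq. Qed.

Lemma level_set_sorted j : sorted (fun a b : 'I_l => (a < b)%N) (level_set j).
Proof.
apply: sorted_filter => [? ? ?|]; first exact: ltn_trans.
by have := iota_ltn_sorted 0 l; rewrite -val_enum_ord sorted_map.
Qed.

Lemma index_level_set j : (index j (level_set j) < size (level_set j))%N.
Proof. by rewrite index_mem mem_level_set. Qed.

Lemma mirrorE j :
  mirror j = nth j (level_set j) (size (level_set j) - (index j (level_set j)).+1).
Proof. by rewrite /mirror nth_rev // index_level_set. Qed.

Lemma label_mirror j : g (mirror j) = g j.
Proof.
apply/eqP; rewrite -mem_level_set mirrorE mem_nth //.
by rewrite ltn_subrL (leq_ltn_trans _ (index_level_set j)).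
Qed.

Lemma level_set_mirror j : level_set (mirror j) = level_set j.
Proof. by apply: eq_filter => i; rewrite label_mirror. Qed.

Lemma mirrorK : involutive mirror.
Proof.
move=> j; have lt_j : (index j (level_set j) < size (level_set j))%N.
  exact: index_level_set.
have E : index (mirror j) (level_set j) =
    (size (level_set j) - (index j (level_set j)).+1)%N.
  by rewrite mirrorE index_uniq ?level_set_uniq // ltn_subrL (leq_ltn_trans _ lt_j).
rewrite (mirrorE (mirror j)) level_set_mirror E subnSK // subKn; last exact: ltnW.
by rewrite (set_nth_default j) // nth_index // mem_level_set.
Qed.

Lemma mirror_anti i j : g i = g j -> (i < j)%N -> (mirror j < mirror i)%N.
Proof.
move=> gij ij; have eqS : level_set i = level_set j.
  by apply: eq_filter => a; rewrite gij.
have lt_i := index_level_set i; have lt_j := index_level_set j.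
have mono a b : (b < size (level_set j))%N -> (a < b)%N ->
    (nth j (level_set j) a < nth j (level_set j) b)%N.
  move=> lt_b ab; have tr : transitive (fun a b : 'I_l => (a < b)%N).
    by move=> ? ? ?; apply: ltn_trans.
  by apply: (sorted_ltn_nth tr j (level_set_sorted j)); rewrite ?inE // (ltn_trans ab).
have nth_i : nth j (level_set j) (index i (level_set j)) = i.
  by rewrite nth_index // mem_level_set gij.
have nth_j : nth j (level_set j) (index j (level_set j)) = j.
  by rewrite nth_index // mem_level_set.
rewrite eqS in lt_i; have lt_ix : (index i (level_set j) < index j (level_set j))%N.
  have [//|/mono lt_ji|E] := ltngtP (index i (level_set j)) (index j (level_set j)).
    by move: (lt_ji lt_i); rewrite nth_i nth_j ltnNge ltnW.
  by move: ij; rewrite -nth_i E nth_j ltnn.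
rewrite !mirrorE eqS (@set_nth_default _ (level_set j) j i).
  apply: mono; first by rewrite ltn_subrL (leq_ltn_trans _ lt_i).
  by apply: ltn_sub2l => //; apply: leq_ltn_trans lt_ix _; apply: index_level_set.
by rewrite ltn_subrL (leq_ltn_trans _ lt_i).
Qed.

End Mirror.

(** * Collisions while a diagram is being lowered *)

Definition lowered n l (A : column_family n l) (m : nat) (v : 'I_n) : nat :=
  \sum_(j < l | (m <= j)%N) (v \in A j).

Definition lowered_diagram n l (A : column_family n l) (m : nat)
    (L : n.-tuple lcell) : n.-tuple lcell :=
  [tuple ((tnth L v).1 - (lowered A m v)%:Z, (tnth L v).2) | v < n].

Lemma lowered_ge n l (A : column_family n l) m v : (l <= m)%N -> lowered A m v = 0%N.
Proof. by move=> lm; apply: big1 => j; have := ltn_ord j; lia. Qed.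

Lemma loweredS n l (A : column_family n l) (m : 'I_l) v :
  lowered A m v = ((v \in A m) + lowered A m.+1 v)%N.
Proof.
rewrite /lowered (bigD1 m) //=; congr addn; apply: eq_bigl => j.
by rewrite -val_eqE /=; lia.
Qed.

Definition cell_lt (c d : lcell) : bool :=
  (c.2 < d.2) || (c.2 == d.2) && (c.1 < d.1).

Lemma sorted_uniq_cell_lt n (L : n.-tuple lcell) (k k' : 'I_n) :
  is_diagram L -> uniq L -> k.+1 = k' :> nat -> cell_lt (tnth L k) (tnth L k').
Proof.
move=> /(sortedP (0, 0)) sortedL uniqL kk'.
have := sortedL k; rewrite size_tuple kk' ltn_ord => /(_ isT).
rewrite -!(tnth_nth (0, 0)) /cell_le /cell_lt => le_kk'.
have := tuple_uniqP L uniqL k k'; move: le_kk'.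
case: (tnth L k) (tnth L k') => [p q] [p' q'] /= le_kk' neq.
have : (p, q) <> (p', q') by move=> /neq kk; move: kk'; rewrite kk; lia.
case: eqP le_kk' => [-> | _]; last by rewrite !orbF.
rewrite ltxx /= => le_p ne; rewrite lt_neqAle le_p andbT.
by apply/eqP => E; case: ne; rewrite E.
Qed.

Lemma uniq_cell_lt n (L : n.-tuple lcell) :
  (forall k k' : 'I_n, k.+1 = k' :> nat -> cell_lt (tnth L k) (tnth L k')) ->
  uniq L.
Proof.
move=> lt_L; apply: (@sorted_uniq _ cell_lt).
- move=> [p q] [p' q'] [p'' q'']; rewrite /cell_lt /=; lia.
- by move=> [p q]; rewrite /cell_lt /=; lia.
- apply/(sortedP (0, 0)) => i; rewrite size_tuple => lt_i.
  by have := lt_L (Ordinal (ltnW lt_i)) (Ordinal lt_i) erefl; rewrite !(tnth_nth (0, 0)).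
Qed.

Definition collision n l (L : n.-tuple lcell) (A : column_family n l)
    (q : 'I_l * ('I_n * 'I_n)) : bool :=
  (q.2.1.+1 == q.2.2)%N &&
  (tnth (lowered_diagram A q.1 L) q.2.1 == tnth (lowered_diagram A q.1 L) q.2.2).

Definition last_collision n l (L : n.-tuple lcell) (A : column_family n l)
    (q : 'I_l * ('I_n * 'I_n)) : bool :=
  collision L A q &&
  [forall q' : 'I_l * ('I_n * 'I_n), (q.1 < q'.1)%N ==> ~~ collision L A q'].

(** One column moves a cell by at most one step, so two cells that are
    consecutive in the order either stay in order or become equal. *)
Lemma no_collision_cell_lt n l (L : n.-tuple lcell) (A : column_family n l)
    (m : nat) (k k' : 'I_n) :
  is_diagram L -> uniq L -> k.+1 = k' :> nat ->
  (forall m' : 'I_l, (m <= m')%N -> ~~ collision L A (m', (k, k'))) ->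
  cell_lt (tnth (lowered_diagram A m L) k) (tnth (lowered_diagram A m L) k').
Proof.
move=> sortedL uniqL kk'; have [d le_d] := ubnP (l - m)%N.
elim: d m le_d => // d IHd m le_d noC; have [lm | ml] := leqP l m.
  rewrite !tnth_mktuple !lowered_ge // !subr0 -!surjective_pairing.
  exact: sorted_uniq_cell_lt.
have : cell_lt (tnth (lowered_diagram A m.+1 L) k) (tnth (lowered_diagram A m.+1 L) k').
  by apply: IHd => [|m' /ltnW]; [lia | apply: noC].
have := noC (Ordinal ml) (leqnn m).
rewrite /collision /= kk' eqxx !tnth_mktuple /=.
rewrite (loweredS A (Ordinal ml) k) (loweredS A (Ordinal ml) k') xpair_eqE /cell_lt /=.
by case: (k \in _); case: (k' \in _); lia.
Qed.

(** * The Bender-Knuth exchange of two consecutive entries *)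

Section ExchangeRows.
Variables (n l : nat) (m : 'I_l) (k k' : 'I_n).
Hypothesis kk' : k.+1 = k' :> nat.
Implicit Type A : column_family n l.

(** Two columns left of m share a label when they have the same number of
    entries below k and the same number of entries up to k'; every other column
    has a label of its own and is therefore fixed by [mirror]. *)
Definition column_label A (j : 'I_l) : nat * nat * nat :=
  if (j < m)%N then (0%N, count_below k (A j), count_below k'.+1 (A j))
  else (1%N, nat_of_ord j, 0%N).

(** This is the Bender-Knuth involution on the columns left of m. In a dominated
    family, a run of equal labels whose columns contain exactly one of k and k'
    reads, from left to right, a copies of k and then b copies of k'. Exchanging
    k and k' and reversing the run gives b copies of k and then a copies of k'.
    On the runs whose columns contain both or neither nothing changes. *)
Definition exchange_rows A : column_family n l :=
  [ffun j : 'I_l => [set u : 'I_n |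
    if (j < m)%N && ((u == k) || (u == k')) then
      tperm k k' u \in A (mirror (column_label A) j)
    else u \in A j]].

Lemma neq_kk' : k != k'. Proof. by rewrite -val_eqE /= -kk' neq_ltn ltnSn. Qed.

Lemma mirror_lt A (j : 'I_l) : (j < m)%N ->
  [/\ (mirror (column_label A) j < m)%N,
    count_below k (A (mirror (column_label A) j)) = count_below k (A j) &
    count_below k'.+1 (A (mirror (column_label A) j)) = count_below k'.+1 (A j)].
Proof.
move=> jm; have := label_mirror (column_label A) j; rewrite /column_label jm.
by case: ifP => // _ [].
Qed.

Lemma mirror_ge A (j : 'I_l) : (m <= j)%N -> mirror (column_label A) j = j.
Proof.
move=> mj; have := label_mirror (column_label A) j.
set i := mirror _ j; rewrite /column_label [(j < m)%N]ltnNge mj /=.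
by case: ifP => // _ [] /val_inj.
Qed.

Lemma mem_exchange_rows A j (u : 'I_n) : (u == k) || (u == k') ->
  (u \in exchange_rows A j) =
  ((if (j < m)%N then tperm k k' u else u) \in A (mirror (column_label A) j)).
Proof.
move=> uk; rewrite ffunE inE uk andbT; case: ltnP => // mj.
by rewrite mirror_ge.
Qed.

Lemma mem_exchange_rows_neq A j (u : 'I_n) : u != k -> u != k' ->
  (u \in exchange_rows A j) = (u \in A j).
Proof. by rewrite ffunE inE => /negbTE -> /negbTE ->; rewrite andbF. Qed.

Lemma exchange_rows_ge A (j : 'I_l) : (m <= j)%N -> exchange_rows A j = A j.
Proof. by move=> mj; apply/setP => u; rewrite ffunE inE ltnNge mj. Qed.

Lemma count_below_k' A j :
  count_below k' (A j) = ((k \in A j) + count_below k (A j))%N.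
Proof. by rewrite -kk' count_belowS. Qed.

(** Columns with the same label contain equally many of the two entries, so that
    only the count of entries up to k is affected. *)
Lemma count_below_exchange_rows A j (w : nat) : w != k' :> nat -> (w <= n)%N ->
  count_below w (exchange_rows A j) = count_below w (A j).
Proof.
have [mj _ _ | jm] := leqP m j; first by rewrite exchange_rows_ge.
have le_k w' : (w' <= k)%N -> count_below w' (exchange_rows A j) = count_below w' (A j).
  move=> w'k; apply: eq_card => u; rewrite !inE.
  case: (ltnP u w') => uw; rewrite ?andbF // mem_exchange_rows_neq //.
    by rewrite -val_eqE /=; lia.
  by rewrite -val_eqE /=; lia.
elim: w => [_ _|w IHw wk' wn]; first exact: le_k.
have [|kw] := leqP w.+1 k; first exact: le_k.
have [wE|nwk'] := eqVneq w (k' : nat).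
  (* The level just above k': here the counts agree by the choice of labels. *)
  rewrite wE !count_belowS -kk' !count_belowS le_k // !mem_exchange_rows ?eqxx ?orbT //.
  rewrite jm tpermL tpermR.
  have [_ c_k] := mirror_lt A jm.
  rewrite !count_belowS -kk' !count_belowS c_k; lia.
rewrite (count_belowS (Ordinal wn)) (count_belowS (Ordinal wn) (A j)) IHw ?(ltnW wn) //.
by rewrite mem_exchange_rows_neq // -val_eqE /=; lia.
Qed.

Lemma column_label_exchange_rows A : column_label (exchange_rows A) =1 column_label A.
Proof.
have lt_k' := ltn_ord k'; move=> j.
by rewrite /column_label !count_below_exchange_rows //; lia.
Qed.

Lemma mirror_exchange_rows A :
  mirror (column_label (exchange_rows A)) =1 mirror (column_label A).
Proof.
move=> j; rewrite /mirror (_ : level_set _ j = level_set (column_label A) j) //.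
by apply: eq_filter => i; rewrite !column_label_exchange_rows.
Qed.

Lemma exchange_rowsK : involutive exchange_rows.
Proof.
move=> A; apply/ffunP => j; apply/setP => u.
have [uk | ] := boolP ((u == k) || (u == k')); last first.
  by rewrite negb_or => /andP[? ?]; rewrite !mem_exchange_rows_neq.
rewrite mem_exchange_rows // mirror_exchange_rows.
case: ltnP => jm; last by rewrite mirror_ge // exchange_rows_ge.
have [rm _ _] := mirror_lt A jm.
rewrite mem_exchange_rows ?rm ?mirrorK ?tpermK //.
by case/orP: uk => /eqP ->; rewrite ?tpermL ?tpermR eqxx ?orbT.
Qed.

Lemma card_exchange_rows A j : #|exchange_rows A j| = #|A j|.
Proof.
rewrite -!(count_below_all _ (leqnn n)) count_below_exchange_rows //.
by have := ltn_ord k'; lia.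
Qed.

(** Only the count of entries up to k needs care. Call it e j, and write c j and d j
    for the counts of entries below k and up to k', which do not change. The new
    count is c j + d j - e (mirror j). Within a label this is
    decreasing because [mirror] reverses the order. Between different labels
    the bounds c <= e <= c + 1 and d - 1 <= e <= d suffice. Between columns m - 1
    and m it is used that column m does not contain k, so that e m = c m. *)
Lemma dominated_exchange_rows A :
  dominated A -> k \notin A m -> dominated (exchange_rows A).
Proof.
move=> /dominatedP domA kA; apply: dominated_adjacent => w j j' jj' wn.
have le_jj' : (j <= j')%N by rewrite -jj' leqnSn.
have [wk'|nwk'] := eqVneq w (k' : nat); last first.
  by rewrite !count_below_exchange_rows // domA.
rewrite {}wk' in wn *; set rho := mirror (column_label A).
have midE (i : 'I_l) : (i < m)%N -> count_below k' (exchange_rows A i) =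
    ((k' \in A (rho i)) + count_below k (A i))%N.
  have lt_k := ltn_ord k; move=> im.
  rewrite -kk' count_belowS count_below_exchange_rows; try lia.
  by rewrite mem_exchange_rows ?eqxx // im tpermL.
have [mj | jm] := leqP m j.
  by rewrite !exchange_rows_ge ?domA // (leq_trans mj).
rewrite (midE j jm); have [mj' | j'm] := leqP m j'.
  rewrite exchange_rows_ge //.
  have -> : j' = m by apply: val_inj => /=; lia.
  rewrite count_below_k' (negbTE kA) add0n (leq_trans _ (leq_addl _ _)) // domA //; lia.
rewrite (midE j' j'm).
have sumE (i : 'I_l) : (i < m)%N ->
    ((k' \in A (rho i)) + count_below k (A i) + count_below k' (A (rho i)) =
     count_below k (A i) + count_below k'.+1 (A i))%N.
  move=> im; have [_ _ <-] := mirror_lt A im.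
  by rewrite (count_belowS k') addnAC addnC addnA addnC.
have bounds (i : 'I_l) : (i < m)%N ->
    (count_below k'.+1 (A i) <= (k' \in A (rho i)) + count_below k (A i) + 1)%N /\
    ((k' \in A (rho i)) + count_below k (A i) <= count_below k'.+1 (A i))%N.
  move=> im; have [_ <- <-] := mirror_lt A im.
  rewrite count_belowS count_below_k'.
  by case: (k' \in _); case: (k \in _); split; lia.
have dom_c := domA k _ _ le_jj'; have dom_d := domA k'.+1 _ _ le_jj'.
have [E|ne] := eqVneq (column_label A j) (column_label A j').
  have lt_rho : (rho j' < rho j)%N by apply: mirror_anti; rewrite // -jj'.
  have := domA k' _ _ (ltnW lt_rho).
  have := sumE j jm; have := sumE j' j'm.
  by move: E; rewrite /column_label jm j'm => -[-> ->]; lia.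
have [le_d _] := bounds j jm; have [_ le_d'] := bounds j' j'm.
move: ne; rewrite /column_label jm j'm !xpair_eqE /= negb_and => /orP[ne_c|ne_d].
  have lt_c : (count_below k (A j') < count_below k (A j))%N.
    by rewrite ltn_neqAle eq_sym ne_c.
  by apply: leq_trans (leq_addl _ _); apply: leq_trans lt_c; rewrite -add1n leq_add2r leq_b1.
have lt_d : (count_below k'.+1 (A j') < count_below k'.+1 (A j))%N.
  by rewrite ltn_neqAle eq_sym ne_d.
rewrite -ltnS; apply: leq_ltn_trans le_d' _; apply: leq_trans lt_d _.
by rewrite -[X in (_ <= X)%N]addn1.
Qed.

Lemma lowered_exchange_rows_ge A m' v : (m <= m')%N ->
  lowered (exchange_rows A) m' v = lowered A m' v.
Proof.
move=> mm'; apply: eq_bigr => j m'j.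
by rewrite exchange_rows_ge // (leq_trans mm').
Qed.

Lemma lowered_split A v :
  lowered A 0 v = (\sum_(j < l | (j < m)%N) (v \in A j) + lowered A m v)%N.
Proof.
rewrite /lowered (bigID (fun j : 'I_l => (j < m)%N)) /=; congr addn.
by apply: eq_bigl => j; rewrite -leqNgt.
Qed.

(** Cells k and k' coincide once the columns from m on are applied, and the
    exchange swaps how often the remaining columns lower each of the two. *)
Lemma lowered_exchange_rows A (L : n.-tuple lcell) v :
  tnth (lowered_diagram A m L) k = tnth (lowered_diagram A m L) k' ->
  tnth (lowered_diagram (exchange_rows A) 0 L) v =
  tnth (lowered_diagram A 0 L) (tperm k k' v).
Proof.
rewrite !tnth_mktuple => -[eq_p eq_q].
have head (u : 'I_n) : (u == k) || (u == k') ->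
    (\sum_(j < l | j < m) (u \in exchange_rows A j) =
     \sum_(j < l | j < m) (tperm k k' u \in A j))%N.
  move=> uk; rewrite [RHS](reindex_inj (inv_inj (mirrorK (column_label A)))) /=.
  apply: eq_big => [j | j jm]; last by rewrite mem_exchange_rows // jm.
  have [mj|jm] := leqP m j; first by rewrite mirror_ge // ltnNge mj.
  by have [-> _ _] := mirror_lt A jm.
rewrite !lowered_split lowered_exchange_rows_ge //.
case: tpermP => [-> | -> | /eqP vk /eqP vk'].
- by rewrite head ?eqxx // tpermL eq_q !PoszD !opprD !(addrCA _ (- _)) eq_p.
- by rewrite head ?eqxx ?orbT // tpermR eq_q !PoszD !opprD !(addrCA _ (- _)) eq_p.
congr (_ - (_ + _)%N%:Z, _); apply: eq_bigr => j _.
by rewrite mem_exchange_rows_neq.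
Qed.

End ExchangeRows.

(** * Cancellation of the tableaux with a collision *)

Lemma no_last_collision n l (L : n.-tuple lcell) (A : column_family n l) :
  [forall q, ~~ last_collision L A q] = [forall q, ~~ collision L A q].
Proof.
apply/forallP/forallP => noC q; last by rewrite negb_and noC.
have [d le_d] := ubnP (l - q.1)%N; elim: d q le_d => // d IHd q le_d.
apply/negP => Cq; have /negP := noC q; apply; rewrite /last_collision Cq /=.
apply/forallP => q'; apply/implyP => lt_q; apply: IHd.
by apply: leq_trans (ltn_sub2l _ lt_q) _; [apply: ltn_ord | rewrite -ltnS].
Qed.

(** Before column m is applied cell k still precedes cell k', so a collision at
    m is caused by lowering k' and not k. *)
Lemma last_collision_step n l (L : n.-tuple lcell) (A : column_family n l) m
    (k k' : 'I_n) :
  is_diagram L -> uniq L -> last_collision L A (m, (k, k')) -> k \notin A m.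
Proof.
move=> sortedL uniqL /andP[/andP[/= /eqP kk' /eqP eqC] /forallP noC].
have lt_S : cell_lt (tnth (lowered_diagram A m.+1 L) k)
                    (tnth (lowered_diagram A m.+1 L) k').
  apply: no_collision_cell_lt => // m' mm'; exact: (implyP (noC (m', (k, k')))).
move: eqC lt_S; rewrite !tnth_mktuple !(loweredS A m) => -[].
by rewrite /cell_lt /=; case: (k \in _); case: (k' \in _) => //; lia.
Qed.

(** Collisions at m or later only involve the columns from m on, which the
    exchange leaves alone. *)
Lemma last_collision_exchange_rows n l (L : n.-tuple lcell)
    (A : column_family n l) m (k k' : 'I_n) :
  k.+1 = k' :> nat -> last_collision L A (m, (k, k')) ->
  last_collision L (exchange_rows m k k' A) =1 last_collision L A.
Proof.
move=> kk' CA; pose A' := exchange_rows m k k' A.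
have eqC (q : 'I_l * ('I_n * 'I_n)) :
    (m <= q.1)%N -> collision L A' q = collision L A q.
  by move=> mq; rewrite /collision !tnth_mktuple !lowered_exchange_rows_ge.
have CA' : last_collision L A' (m, (k, k')).
  case/andP: CA => CA /forallP noC; rewrite /last_collision eqC // CA.
  apply/forallP => q; apply/implyP => mq; rewrite eqC ?(ltnW mq) //.
  exact: (implyP (noC q)).
move=> q; have [mq | qm] := leqP m q.1.
  rewrite /last_collision eqC //; congr (_ && _); apply: eq_forallb => q'.
  by case: ltnP => //= qq'; rewrite eqC // ltnW // (leq_ltn_trans mq).
have noq B : last_collision L B (m, (k, k')) -> last_collision L B q = false.
  case/andP=> CB _; apply/negbTE; rewrite negb_and; apply/orP; right.
  by apply/forallPn; exists (m, (k, k')); rewrite /= qm CB.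
by rewrite !noq.
Qed.

(** Exchanging k and k' in the columns left of m, where m is the last column with
    a collision, swaps the final cells of index k and k'. *)
Lemma sum_Delta_no_collision n l (L : n.-tuple lcell) (h : 'I_l -> nat) :
  is_diagram L -> uniq L ->
  \sum_(A : column_family n l | dominated A && [forall j, #|A j| == h j])
    Delta (lowered_diagram A 0 L) =
  \sum_(A : column_family n l | (dominated A && [forall j, #|A j| == h j]) &&
      [forall q, ~~ collision L A q])
    Delta (lowered_diagram A 0 L).
Proof.
move=> sortedL uniqL.
rewrite (sum_sign_reversing (R := fun A q => last_collision L A q)
  (f := fun q A => exchange_rows q.1 q.2.1 q.2.2 A)).
  by apply: eq_bigl => A; rewrite no_last_collision.
move=> A [m [k k']] /= /andP[domA szA] CA.
have kA := last_collision_step sortedL uniqL CA.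
have /andP[/andP[/= /eqP kk' /eqP eqC] _] := CA; split.
- rewrite dominated_exchange_rows //=; apply/forallP => j.
  by rewrite card_exchange_rows // (forallP szA).
- exact: last_collision_exchange_rows.
- exact: exchange_rowsK.
- apply: (Delta_swap (neq_kk' kk')) => v; exact: lowered_exchange_rows.
Qed.

Lemma no_collision_uniq n l (L : n.-tuple lcell) (A : column_family n l) :
  is_diagram L -> uniq L ->
  [forall q, ~~ collision L A q] = [forall m : 'I_l, uniq (lowered_diagram A m L)].
Proof.
move=> sortedL uniqL; apply/forallP/forallP => [noC m | uniqA [m [k k']]].
  by apply: uniq_cell_lt => k k' kk'; apply: no_collision_cell_lt.
apply/negP => /andP[/= /eqP kk' /eqP /(tuple_uniqP _ (uniqA m)) E].
by move: kk'; rewrite E; lia.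
Qed.

(** Without collisions, a vanishing factor eps comes from a cell outside the
    quadrant; as cells only move down, it is outside at the end as well and
    Delta vanishes. *)
Lemma sum_Delta_eps n l (L : n.-tuple lcell) (h : 'I_l -> nat) :
  is_diagram L -> uniq L -> all in_quadrant L ->
  \sum_(A : column_family n l | dominated A && [forall j, #|A j| == h j])
    Delta (lowered_diagram A 0 L) =
  \sum_(A : column_family n l | dominated A && [forall j, #|A j| == h j])
    Delta (lowered_diagram A 0 L) *+ \prod_(m < l) eps (lowered_diagram A m L).
Proof.
move=> sortedL uniqL /all_tnthP Lq; rewrite sum_Delta_no_collision // big_mkcondr.
apply: eq_bigr => A _; rewrite no_collision_uniq //.
case: ifPn => [/forallP uniqA | /forallPn[m /negbTE nuniq]]; last first.
  by rewrite (bigD1 m) //= /eps nuniq mul0n mulr0n.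
have [A_q | A_nq] := boolP (all in_quadrant (lowered_diagram A 0 L)); last first.
  by rewrite Delta_out_of_quadrant // mul0rn.
rewrite big1 // => m _; rewrite /eps uniqA; apply/eqP; rewrite eqb1.
apply/all_tnthP => v; have := all_tnthP A_q v; rewrite !tnth_mktuple (lowered_split m).
by rewrite /in_quadrant /=; lia.
Qed.

(** * Column-strict tableaux and their column sets *)

(** Used both for the conjugate partition and for the sorted list of the
    elements of a set. *)
Lemma nth_lt_count (T : Type) (P : pred T) (x0 : T) (s : seq T) (i : nat) :
  sorted (fun x y => P y ==> P x) s -> (i < size s)%N ->
  P (nth x0 s i) = (i < count P s)%N.
Proof.
have tr : transitive (fun x y => P y ==> P x).
  by move=> y x z; case: (P x); case: (P y); case: (P z).
elim: s i => [|x s IHs] //= i sorted_s lt_i.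
have [Px|nPx] := boolP (P x).
  by case: i lt_i => [|i] //= lt_i; rewrite IHs // (path_sorted sorted_s).
have s0 : all (predC P) s.
  apply: sub_all (order_path_min tr sorted_s) => y /=.
  by rewrite (negbTE nPx) implybF.
have c0 : count P s = 0%N.
  by apply/eqP; rewrite eqn0Ngt -has_count -all_predC.
rewrite c0 addn0 ltn0; case: i lt_i => [|i] /= lt_i; first exact: negbTE.
by apply: negbTE; apply: (all_nthP x0 s0).
Qed.

Lemma enum_val_lt n (S : {set 'I_n}) (i : 'I_#|S|) v :
  (enum_val i < v)%N = (i < count_below v S)%N.
Proof.
have -> : count_below v S = count (fun u : 'I_n => (u < v)%N) (enum S).
  rewrite /count_below cardE -size_filter /enum_mem -filter_predI.
  by congr size; apply: eq_filter => u; rewrite /= inE andbC.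
have x0 : 'I_n by apply: enum_val i.
rewrite (enum_val_nth x0) (nth_lt_count (P := fun u : 'I_n => (u < v)%N)) -?cardE //.
apply: (@sub_sorted _ (fun a b : 'I_n => (a < b)%N)) => [a b /= ab|].
  by apply/implyP; apply: ltn_trans.
rewrite /enum_mem; apply: sorted_filter => [? ? ?|]; first exact: ltn_trans.
by have := iota_ltn_sorted 0 n; rewrite -val_enum_ord enumT sorted_map.
Qed.

Section Columns.
Variables (n : nat) (lam : seq nat).
Hypothesis sorted_lam : sorted geq lam.
Implicit Types (T : {ffun ferrers lam -> 'I_n}) (c d : ferrers lam).
Implicit Type A : column_family n (ncols lam).

Lemma nth_part_decr i j : (i <= j)%N -> (nth 0 lam j <= nth 0 lam i)%N.
Proof.
move=> ij; have [sj|js] := leqP (size lam) j; first by rewrite (nth_default 0%N sj).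
apply: (sorted_leq_nth (leT := geq) _ _ _ sorted_lam) => //.
- by move=> y x z /= xy yz; apply: leq_trans xy.
- by move=> x; apply: leqnn.
- by rewrite inE (leq_ltn_trans ij).
Qed.

Lemma lt_conj_part i j : (j < nth 0 lam i)%N = (i < conj_part lam j)%N.
Proof.
have [si|is_] := leqP (size lam) i.
  rewrite nth_default // ltn0; apply/esym/negbTE; rewrite -leqNgt.
  exact: leq_trans (count_size _ _) si.
apply: (nth_lt_count (P := fun r => (j < r)%N)) => //.
apply: sub_sorted sorted_lam => x y /= yx; apply/implyP => jy; exact: leq_trans yx.
Qed.

Lemma conj_part_decr i j : (i <= j)%N -> (conj_part lam j <= conj_part lam i)%N.
Proof. by move=> ij; apply: sub_count => r /=; apply: leq_ltn_trans. Qed.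

Lemma frow_lt c : (frow c < conj_part lam (fcol c))%N.
Proof. by rewrite -lt_conj_part; apply: (valP c). Qed.

Lemma ferrers_cell i j : (i < conj_part lam j)%N ->
  {c : ferrers lam | frow c = i & fcol c = j}.
Proof.
rewrite -lt_conj_part => lt_j.
have lt_i : (i < size lam)%N.
  by rewrite ltnNge; apply/negP => si; rewrite nth_default in lt_j.
have lt_l : (j < ncols lam)%N.
  by rewrite /ncols -nth0; apply: leq_trans lt_j _; apply: nth_part_decr.
pose p := (Ordinal lt_i, Ordinal lt_l); have in_p : in_ferrers p by [].
by exists (exist _ p in_p : ferrers lam).
Qed.

Lemma ferrers_ext c d : frow c = frow d -> fcol c = fcol d -> c = d.
Proof.
move=> eq_r eq_c; apply: val_inj.
have Er : (val c).1 = (val d).1 by apply: val_inj.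
have Ec : (val c).2 = (val d).2 by apply: val_inj.
by case: (val c) (val d) Er Ec => [i j] [i' j'] /= -> ->.
Qed.

Lemma column_strictP T :
  reflect ((forall c d, frow d = frow c -> fcol d = (fcol c).+1 -> (T c <= T d)%N) /\
           (forall c d, frow d = (frow c).+1 -> fcol d = fcol c -> (T c < T d)%N))
          (column_strict T).
Proof.
apply: (iffP forallP) => [cs | [wk st] c].
  by split=> c d /eqP E1 /eqP E2; have /forallP/(_ d) := cs c;
     rewrite E1 E2 => /andP[/implyP H1 /implyP H2]; [apply: H1 | apply: H2].
by apply/forallP => d; apply/andP; split; apply/implyP => /andP[/eqP ? /eqP ?]; auto.
Qed.

Lemma column_lt T c d : column_strict T -> fcol c = fcol d ->
  (frow c < frow d)%N -> (T c < T d)%N.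
Proof.
case/column_strictP => _ st eq_c; move: {2}(frow d) (erefl (frow d)) => r.
elim: r d eq_c => [|r IHr] d eq_c eq_r; first by rewrite eq_r.
rewrite eq_r ltnS leq_eqVlt => /orP[/eqP cr|cr]; first by apply: st => //; rewrite cr.
have [|d' rd' cd'] := @ferrers_cell r (fcol d).
  by apply: leq_trans (frow_lt d); rewrite eq_r.
apply: (@leq_trans (T d')); last by apply: ltnW; apply: st; rewrite ?rd' ?cd'.
by apply: (IHr d'); rewrite ?rd' ?cd'.
Qed.

Lemma column_inj T c d : column_strict T -> fcol c = fcol d -> T c = T d -> c = d.
Proof.
move=> csT eq_c eq_T; apply: ferrers_ext => //.
by have [/(column_lt csT eq_c)|/(column_lt csT (esym eq_c))|//] := ltngtP (frow c) (frow d);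
   rewrite eq_T ltnn.
Qed.

Definition column_sets T : column_family n (ncols lam) :=
  [ffun j : 'I_(ncols lam) => [set T c | c : ferrers lam & fcol c == j]].

(** Inside one column a cell is determined by its row, so that cells of
    different columns can be compared through their rows. *)
Lemma card_cells (P : pred (ferrers lam)) (j : nat) :
  #|[set c | (fcol c == j) && P c]| =
  #|[set i : 'I_(size lam) | [exists c, [&& fcol c == j, P c & frow c == i]]]|.
Proof.
rewrite -(@card_in_imset _ _ (fun c : ferrers lam => (val c).1)).
  apply: eq_card => i; rewrite inE; apply/imsetP/existsP => -[c].
    by rewrite inE => /andP[cj Pc] ->; exists c; rewrite cj Pc /=.
  case/and3P => cj Pc /eqP ci; exists c; first by rewrite inE cj.
  exact: val_inj.
move=> c d; rewrite !inE => /andP[/eqP cj _] /andP[/eqP dj _] E.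
by apply: ferrers_ext; [rewrite /frow E | rewrite cj].
Qed.

Lemma card_ord_lt s r : (r <= s)%N -> #|[set i : 'I_s | (i < r)%N]| = r.
Proof.
move=> rs; rewrite -sum1dep_card -(big_ord_widen _ (fun _ => 1%N)) //.
by rewrite sum1_card card_ord.
Qed.

Lemma count_below_column_sets T (j : 'I_(ncols lam)) v : column_strict T ->
  count_below v (column_sets T j) = #|[set c | (fcol c == j) && (T c < v)%N]|.
Proof.
move=> csT; rewrite -(@card_in_imset _ _ T).
  apply: eq_card => u; rewrite !inE ffunE; apply/andP/imsetP => [[/imsetP[c]]|[c]].
    by rewrite inE => cj -> Tv; exists c; rewrite ?inE ?cj.
  rewrite inE => /andP[cj Tv] ->; split=> //; apply/imsetP; exists c => //.
  by rewrite inE.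
move=> c d; rewrite !inE => /andP[/eqP cj _] /andP[/eqP dj _].
by apply: column_inj; rewrite ?cj.
Qed.

Lemma card_column_sets T (j : 'I_(ncols lam)) : column_strict T ->
  #|column_sets T j| = conj_part lam j.
Proof.
move=> csT; rewrite -(count_below_all _ (leqnn n)) count_below_column_sets // card_cells.
rewrite -[RHS](@card_ord_lt (size lam)) ?count_size //; apply: eq_card => i; rewrite !inE.
apply/existsP/idP => [[c /and3P[/eqP <- _ /eqP <-]]|]; first exact: frow_lt.
by case/ferrers_cell => c ci cj; exists c; rewrite ci cj !eqxx ltn_ord.
Qed.

(** Entries increase down a column, so its cells with entry below v are those in
    the first rows. This recovers the tableau from its column sets. *)
Lemma tableau_entry_lt T c v : column_strict T ->
  (T c < v)%N = (frow c < count_below v (column_sets T (val c).2))%N.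
Proof.
move=> csT; rewrite count_below_column_sets // card_cells.
have le_size : (frow c < size lam)%N by apply: ltn_ord.
apply/idP/idP => [Tv|].
  rewrite -[X in (X <= _)%N](card_ord_lt le_size); apply: subset_leq_card.
  apply/subsetP => i; rewrite !inE ltnS => ic.
  have [|d di dj] := @ferrers_cell i (fcol c); first exact: leq_ltn_trans (frow_lt c).
  apply/existsP; exists d; rewrite di dj !eqxx andbT /=.
  move: ic; rewrite leq_eqVlt => /orP[/eqP ic|ic].
    by rewrite (@ferrers_ext d c) // di.
  by apply: ltn_trans Tv; apply: column_lt; rewrite ?di.
apply: contraLR; rewrite -!leqNgt => vT.
rewrite -[X in (_ <= X)%N](card_ord_lt (ltnW le_size)); apply: subset_leq_card.
apply/subsetP => i; rewrite !inE => /existsP[d /and3P[/eqP dj Td /eqP <-]].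
rewrite ltnNge leq_eqVlt; apply/negP => /orP[/eqP cd|cd].
  by move: Td; rewrite (@ferrers_ext d c) // ltnNge vT.
by have := column_lt csT (esym dj) cd; rewrite ltnNge (leq_trans (ltnW Td)).
Qed.

Lemma column_sets_inj :
  {in @tableaux n lam &, injective column_sets}.
Proof.
move=> T1 T2; rewrite !inE => cs1 cs2 E; apply/ffunP => c; apply: val_inj.
have lt v : (T1 c < v)%N = (T2 c < v)%N.
  by rewrite (tableau_entry_lt _ _ cs1) (tableau_entry_lt _ _ cs2) E.
apply/eqP; rewrite eqn_leq; apply/andP; split.
  by have := lt (T2 c).+1; rewrite !ltnS leqnn.
by have := lt (T1 c).+1; rewrite !ltnS leqnn => <-.
Qed.

Lemma dominated_column_sets T : column_strict T -> dominated (column_sets T).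
Proof.
move=> csT; apply: dominated_adjacent => v j j' jj' _.
rewrite !count_below_column_sets // !card_cells; apply: subset_leq_card.
apply/subsetP => i; rewrite !inE => /existsP[d /and3P[/eqP dj' Td /eqP <-]].
have [|c cr cj] := @ferrers_cell (frow d) j.
  by apply: leq_trans (frow_lt d) _; apply: conj_part_decr; rewrite dj' -jj'.
apply/existsP; exists c; rewrite cr cj !eqxx andbT /=.
have /column_strictP[wk _] := csT; apply: leq_ltn_trans Td; apply: wk; first by rewrite cr.
by rewrite cj dj' jj'.
Qed.

(** The tableau is filled by listing each set in increasing order. *)
Lemma column_sets_onto A :
  dominated A -> (forall j, #|A j| = conj_part lam j) ->
  exists2 T, column_strict T & column_sets T = A.
Proof.
move=> /dominatedP domA szA.
have lt_row c : (frow c < #|A (val c).2|)%N by rewrite szA frow_lt.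
pose T : {ffun ferrers lam -> 'I_n} := [ffun c => enum_val (Ordinal (lt_row c))].
have T_lt c v : (T c < v)%N = (frow c < count_below v (A (val c).2))%N.
  by rewrite ffunE enum_val_lt.
have TA c : T c \in A (val c).2 by rewrite ffunE; apply: enum_valP.
have csT : column_strict T.
  apply/column_strictP; split=> c d rd cd.
    have : (T d < (T d).+1)%N by [].
    rewrite T_lt rd => lt_d; rewrite -ltnS T_lt; apply: leq_trans lt_d _.
    by apply: domA; move: cd; rewrite /fcol => ->.
  have E : (val d).2 = (val c).2 by apply: val_inj.
  have : (T d < (T d).+1)%N by [].
  by rewrite !T_lt rd E count_belowS -E TA ltnS.
exists T => //; apply/ffunP => j; apply/eqP.
rewrite eqEcard card_column_sets // szA leqnn andbT.
apply/subsetP => u; rewrite ffunE => /imsetP[c]; rewrite inE => /eqP cj ->.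
by have := TA c; rewrite (_ : (val c).2 = j) //; apply: val_inj.
Qed.

Lemma sum_tableaux (V : nmodType) (F : column_family n (ncols lam) -> V) :
  \sum_(T in @tableaux n lam) F (column_sets T) =
  \sum_(A : column_family n (ncols lam) |
     dominated A && [forall j : 'I_(ncols lam), #|A j| == conj_part lam j]) F A.
Proof.
rewrite -(big_imset _ column_sets_inj) /=; apply: eq_bigl => A.
apply/imsetP/andP => [[T]|[domA /forallP szA]].
  rewrite inE => csT ->; split; first exact: dominated_column_sets.
  by apply/forallP => j; rewrite card_column_sets.
have [T csT <-] := column_sets_onto domA (fun j => eqP (szA j)).
by exists T; rewrite ?inE.
Qed.

Lemma card_column_entry T (j : 'I_(ncols lam)) v : column_strict T ->
  #|[set c | (fcol c == j) && (T c == v)]| = (v \in column_sets T j).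
Proof.
move=> csT; rewrite ffunE; case: imsetP => [[c] | noc].
  rewrite inE => /eqP cj ->; rewrite -[RHS](cards1 c); apply: eq_card => d; rewrite !inE.
  apply/andP/eqP => [[/eqP dj /eqP eT]|->]; last by rewrite cj !eqxx.
  by apply: (column_inj csT) => //; rewrite dj cj.
apply: eq_card0 => c; rewrite inE; apply/andP => -[cj /eqP Tv].
by case: noc; exists c; rewrite ?inE.
Qed.

Lemma lower_column T (j : 'I_(ncols lam)) (L : n.-tuple lcell) : column_strict T ->
  lower (column T j) (lowered_diagram (column_sets T) j.+1 L) =
  lowered_diagram (column_sets T) j L.
Proof.
move=> csT; apply: eq_from_tnth => v; rewrite !tnth_mktuple /= loweredS.
rewrite -card_column_entry // -(card_imset _ val_inj).
rewrite (_ : #|_| = #|[set c | (fcol c == j) && (T c == v)]|); last first.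
  apply: eq_card => c; rewrite inE; apply/imsetP/andP => [[d]|[cj Tv]].
    by rewrite inE ffunE => Tv ->; split=> //; apply: (valP d).
  by exists (exist _ c cj) => //; rewrite inE ffunE.
by rewrite PoszD opprD addrA addrAC.
Qed.

Lemma lower_colsE T m (L : n.-tuple lcell) : column_strict T ->
  lower_cols T m L = lowered_diagram (column_sets T) m L.
Proof.
move=> csT; rewrite /lower_cols; have [d le_d] := ubnP (ncols lam - m)%N.
elim: d m le_d => // d IHd m le_d; have [lm | ml] := leqP (ncols lam) m.
  rewrite (eqP (lm : _ - _ == 0)%N) /=; apply: eq_from_tnth => v.
  by rewrite tnth_mktuple lowered_ge // subr0 -surjective_pairing.
rewrite -(subnSK ml) /= IHd; last lia.
exact: (lower_column (Ordinal ml)).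
Qed.

Lemma lowerE T (L : n.-tuple lcell) : column_strict T ->
  lower T L = lowered_diagram (column_sets T) 0 L.
Proof.
move=> csT; apply: eq_from_tnth => v; rewrite !tnth_mktuple.
congr (_ - _%:Z, _); rewrite -sum1dep_card (partition_big (fun c => (val c).2) predT) //=.
apply: eq_bigr => j _; rewrite -card_column_entry // -sum1dep_card.
by apply: eq_bigl => c; rewrite andbC.
Qed.

End Columns.

(** * The action of a Schur polynomial *)

Lemma schur_symmetric n lam : schur n lam \is symmetric.
Proof.
apply: rpred_sum => s _; rewrite -signr_odd; apply: rpredM.
  by case: (odd _); rewrite ?expr0 ?expr1 ?rpredN rpred1.
apply: rpred_prod => i _; rewrite mxE; case: (_ - _) => k /=; last exact: rpred0.
exact: mesym_sym.
Qed.

Lemma shift_weight n l (A : column_family n l) (L : n.-tuple lcell) :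
  shift_diagram L (weight A) = lowered_diagram A 0 L.
Proof.
apply: eq_from_tnth => v; rewrite !tnth_mktuple mnm_sumE.
by congr (_ - _%:Z, _); apply: eq_bigr => j _; rewrite mnmE.
Qed.

Theorem theorem2p1 (n : nat) (L : n.-tuple lcell)
    (L_diagram : is_diagram L) (L_uniq : uniq L)
    (L_quadrant : all in_quadrant L)
    (k : nat) (k_ge1 : (1 <= k)%N)
    (lam : seq nat) (lam_partition : is_partition k lam) :
  diffX (schur n lam) (Delta L)
    = \sum_(T in tableaux n lam) Delta (lower T L) *+ eps' T L
  /\ (forall T, T \in tableaux n lam ->
        lower T L = lower_cols T 0 L /\ (eps' T L = 0%N \/ eps' T L = 1%N)).
Proof.
have [sorted_lam _ _] := and3P lam_partition.
have jt : schur n lam = \sum_(A : column_family n (ncols lam) |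
    dominated A && [forall j : 'I_(ncols lam), #|A j| == conj_part lam j])
    'X_[weight A].
  by apply: dual_jacobi_trudi => i j; apply: conj_part_decr.
split=> [|T]; last first.
  rewrite inE => csT; split; first by rewrite lowerE // lower_colsE.
  rewrite /eps'; apply: (big_ind (fun e => e = 0%N \/ e = 1%N)); first by right.
    by move=> _ _ [->|->] [->|->]; [left|left|left|right].
  by move=> m _; rewrite /eps; case: (_ && _); [right|left].
transitivity (\sum_(T in tableaux n lam)
    Delta (lowered_diagram (column_sets T) 0 L) *+
      \prod_(m < ncols lam) eps (lowered_diagram (column_sets T) m L)).
  rewrite (sum_tableaux sorted_lam (fun A => Delta (lowered_diagram A 0 L) *+
    \prod_(m < ncols lam) eps (lowered_diagram A m L))) -sum_Delta_eps //.
  rewrite jt diffX_sum_Delta //; last by rewrite -jt schur_symmetric.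
  by apply: eq_bigr => A _; rewrite shift_weight.
apply: eq_bigr => T; rewrite inE => csT; rewrite -lowerE //; congr (_ *+ _).
by apply: eq_bigr => m _; rewrite lower_colsE.
Qed.
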